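(* Let $\alpha : I \to E_1^4$ be a spacelike curve parametrized by arclength $s$, with Frenet frame $\{\mathbf{t},\mathbf{n},\mathbf{b}_1,\mathbf{b}_2\}$ and associated signs $\mu_1,\dots,\mu_5$, equiform invariant tetrahedron $\{\mathbf{V}_1,\mathbf{V}_2,\mathbf{V}_3,\mathbf{V}_4\}$ and equiform curvatures $\mathcal{K}_1,\mathcal{K}_2,\mathcal{K}_3$. Then $\alpha$ is a general helix if and only if $$\mathbf{V}_3''+\psi_1\mathbf{V}_3=\psi_2\mathbf{V}_1+\psi_3\mathbf{V}_2+\psi_4\mathbf{V}_4$$ along $\alpha$, where the prime denotes $d/d\sigma$ ($\sigma$ the equiform parameter), the dot denotes $d/ds$, and $$\psi_1=-\left(\rho\dot{\mathcal{K}}_1+\mathcal{K}_1^2+\mu_2\mu_3\mathcal{K}_2^2+\mu_4\mu_5\mathcal{K}_3^2\right),\quad \psi_2=\mu_1\mu_3\mathcal{K}_2,\quad \psi_3=2\mu_3\mathcal{K}_1\mathcal{K}_2,\quad \psi_4=2\mu_4\mathcal{K}_1\mathcal{K}_3.$$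
   Context: $E_1^4$ is $\mathbb{R}^4$ with the pseudo scalar product $\langle x,y\rangle=-x_1y_1+x_2y_2+x_3y_3+x_4y_4$, and $\|x\|=\sqrt{|\langle x,x\rangle|}$. All curves are smooth and defined on an interval $I\subset\mathbb{R}$. A curve $\alpha$ is spacelike if its velocity satisfies $\langle\dot\alpha,\dot\alpha\rangle>0$ everywhere; it is parametrized by arclength $s$ if $\|d\alpha/ds\|=1$. Frenet frame of a spacelike curve: $\alpha$ is assumed to have a pseudo-orthonormal moving frame of non-null vectors $\{\mathbf{t},\mathbf{n},\mathbf{b}_1,\mathbf{b}_2\}$ (mutually orthogonal, with squares $\pm1$), where $\mathbf{t}=d\alpha/ds$, $\kappa_1=\|d^2\alpha/ds^2\|>0$, $\mathbf{n}=\kappa_1^{-1}\,d^2\alpha/ds^2$, and functions $\kappa_2,\kappa_3$ such that $$\frac{d\mathbf{t}}{ds}=\kappa_1\mathbf{n},\quad \frac{d\mathbf{n}}{ds}=\mu_1\kappa_1\mathbf{t}+\mu_2\kappa_2\mathbf{b}_1,\quad \frac{d\mathbf{b}_1}{ds}=\mu_3\kappa_2\mathbf{n}+\mu_4\kappa_3\mathbf{b}_2,\quad \frac{d\mathbf{b}_2}{ds}=\mu_5\kappa_3\mathbf{b}_1,$$ where the causal characters and the signs $\mu_i$ are (constantly along the curve) those of one of the following three cases: (i) $\langle\mathbf{t},\mathbf{t}\rangle=\langle\mathbf{n},\mathbf{n}\rangle=\langle\mathbf{b}_1,\mathbf{b}_1\rangle=1$, $\langle\mathbf{b}_2,\mathbf{b}_2\rangle=-1$,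 with $\mu_1=\mu_3=-1$, $\mu_2=\mu_4=\mu_5=1$; (ii) $\langle\mathbf{t},\mathbf{t}\rangle=\langle\mathbf{n},\mathbf{n}\rangle=\langle\mathbf{b}_2,\mathbf{b}_2\rangle=1$, $\langle\mathbf{b}_1,\mathbf{b}_1\rangle=-1$, with $\mu_1=-1$, $\mu_2=\mu_3=\mu_4=\mu_5=1$; (iii) $\langle\mathbf{t},\mathbf{t}\rangle=\langle\mathbf{b}_1,\mathbf{b}_1\rangle=\langle\mathbf{b}_2,\mathbf{b}_2\rangle=1$, $\langle\mathbf{n},\mathbf{n}\rangle=-1$, with $\mu_1=\mu_2=\mu_3=\mu_4=1$, $\mu_5=-1$. Equiform quantities: $\rho=1/\kappa_1$; the equiform parameter is $\sigma=\int\kappa_1\,ds$, so $d/d\sigma=\rho\,d/ds$. The equiform invariant tetrahedron is $\mathbf{V}_1=\rho\mathbf{t}$, $\mathbf{V}_2=\rho\mathbf{n}$, $\mathbf{V}_3=\rho\mathbf{b}_1$, $\mathbf{V}_4=\rho\mathbf{b}_2$. The equiform curvatures are $\mathcal{K}_1=d\rho/ds$, $\mathcal{K}_2=\kappa_2/\kappa_1$, $\mathcal{K}_3=\kappa_3/\kappa_1$. A spacelike curve is a general helix if and only if $\mathcal{K}_2$ and $\mathcal{K}_3$ are both constant (no condition on $\mathcal{K}_1$); this is taken as the definition. *)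

(* Defs.v *)
From HB Require Import structures.
From mathcomp Require Import all_boot all_order all_algebra.
From mathcomp Require Import all_classical all_reals all_analysis.

Set Implicit Arguments.
Unset Strict Implicit.
Unset Printing Implicit Defensive.

Import Order.TTheory GRing.Theory Num.Theory.
Import numFieldNormedType.Exports.

Local Open Scope classical_set_scope.
Local Open Scope ring_scope.

Section Calculus.
Context {R : realType} {V : normedModType R}.
Implicit Types (I : set R) (u : R -> R) (f : R -> V).

(* Since I may be any interval, possibly containing endpoints, difference
   quotients are restricted to I (so they are one-sided at an endpoint). They
   are taken with respect to an arbitrary parameter u of the curve, so that the
   same definition gives d/ds (u = id) and d/dsigma (u = sigma). *)
Definition diff_quotient I u f (s : R) : set_system V :=
  ((u y - u s)^-1 *: (f y - f s)) @[y --> within I s^'].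

Definition deriv_wrt I u f : R -> V := fun s => lim (diff_quotient I u f s).

Definition deriv_on I f : R -> V := deriv_wrt I id f.

Definition derivable_on I f := forall s, I s -> cvg (diff_quotient I id f s).

(* Values outside I play no role: for s in I, deriv_on I f s only involves f on I. *)
Definition smooth_on I f := forall k : nat, derivable_on I (iter k (deriv_on I) f).

Definition constant_on I f := exists c, forall s, I s -> f s = c.

End Calculus.

Section Minkowski.
Context {R : realType}.
Implicit Types x y : 'rV[R]_4.

Definition mink x y : R :=
  - (x 0 (inord 0) * y 0 (inord 0)) + x 0 (inord 1) * y 0 (inord 1)
  + x 0 (inord 2) * y 0 (inord 2) + x 0 (inord 3) * y 0 (inord 3).

Definition mink_norm x : R := Num.sqrt `|mink x x|.

End Minkowski.

(* The vector of the frame that is timelike. *)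
Inductive causal_case := B2_timelike | B1_timelike | N_timelike.

Section Signs.
Context {R : realType}.
Implicit Type c : causal_case.

Definition eps_n c : R := if c is N_timelike then -1 else 1.
Definition eps_b1 c : R := if c is B1_timelike then -1 else 1.
Definition eps_b2 c : R := if c is B2_timelike then -1 else 1.

Definition sgn1 c : R := if c is N_timelike then 1 else -1.
Definition sgn2 c : R := 1.
Definition sgn3 c : R := if c is B2_timelike then -1 else 1.
Definition sgn4 c : R := 1.
Definition sgn5 c : R := if c is N_timelike then -1 else 1.

End Signs.

Record frenet_curve (R : realType) := FrenetCurve {
  dom : set R;
  pos : R -> 'rV[R]_4;
  tvec : R -> 'rV[R]_4;
  nvec : R -> 'rV[R]_4;
  b1vec : R -> 'rV[R]_4;
  b2vec : R -> 'rV[R]_4;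
  kappa1 : R -> R;
  kappa2 : R -> R;
  kappa3 : R -> R;
  causal : causal_case;

  dom_interval : is_interval dom;
  dom_nondegenerate : exists a b, [/\ dom a, dom b & a < b];

  pos_smooth : smooth_on dom pos;
  frame_smooth : [/\ smooth_on dom tvec, smooth_on dom nvec,
                     smooth_on dom b1vec & smooth_on dom b2vec];

  pos_spacelike : forall s, dom s -> 0 < mink (deriv_on dom pos s) (deriv_on dom pos s);
  pos_arclength : forall s, dom s -> mink_norm (deriv_on dom pos s) = 1;

  tvecE : forall s, dom s -> tvec s = deriv_on dom pos s;
  kappa1E : forall s, dom s -> kappa1 s = mink_norm (deriv_on dom (deriv_on dom pos) s);
  kappa1_gt0 : forall s, dom s -> 0 < kappa1 s;
  nvecE : forall s, dom s ->
    nvec s = (kappa1 s)^-1 *: deriv_on dom (deriv_on dom pos) s;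

  frame_squares : forall s, dom s ->
    [/\ mink (tvec s) (tvec s) = 1,
        mink (nvec s) (nvec s) = eps_n causal,
        mink (b1vec s) (b1vec s) = eps_b1 causal &
        mink (b2vec s) (b2vec s) = eps_b2 causal];
  t_orthogonal : forall s, dom s ->
    [/\ mink (tvec s) (nvec s) = 0,
        mink (tvec s) (b1vec s) = 0 &
        mink (tvec s) (b2vec s) = 0];
  n_orthogonal : forall s, dom s ->
    mink (nvec s) (b1vec s) = 0 /\ mink (nvec s) (b2vec s) = 0;
  b_orthogonal : forall s, dom s -> mink (b1vec s) (b2vec s) = 0;

  frenet_t : forall s, dom s -> deriv_on dom tvec s = kappa1 s *: nvec s;
  frenet_n : forall s, dom s ->
    deriv_on dom nvec s = (sgn1 causal * kappa1 s) *: tvec s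
                     + (sgn2 causal * kappa2 s) *: b1vec s;
  frenet_b1 : forall s, dom s ->
    deriv_on dom b1vec s = (sgn3 causal * kappa2 s) *: nvec s
                      + (sgn4 causal * kappa3 s) *: b2vec s;
  frenet_b2 : forall s, dom s ->
    deriv_on dom b2vec s = (sgn5 causal * kappa3 s) *: b1vec s
}.

Section Equiform.
Context {R : realType}.
Variable C : frenet_curve R.

Definition rho : R -> R := fun s => (kappa1 C s)^-1.

(* sigma is a primitive of kappa1 with respect to arclength. *)
Definition equiform_parameter (sigma : R -> R) :=
  derivable_on (dom C) sigma
  /\ forall s, dom C s -> deriv_on (dom C) sigma s = kappa1 C s.

Definition V1 : R -> 'rV[R]_4 := fun s => rho s *: tvec C s.
Definition V2 : R -> 'rV[R]_4 := fun s => rho s *: nvec C s.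
Definition V3 : R -> 'rV[R]_4 := fun s => rho s *: b1vec C s.
Definition V4 : R -> 'rV[R]_4 := fun s => rho s *: b2vec C s.

Definition K1 : R -> R := deriv_on (dom C) rho.
Definition K2 : R -> R := fun s => kappa2 C s / kappa1 C s.
Definition K3 : R -> R := fun s => kappa3 C s / kappa1 C s.

Definition general_helix := constant_on (dom C) K2 /\ constant_on (dom C) K3.

Local Notation mu1 := (sgn1 (causal C)).
Local Notation mu2 := (sgn2 (causal C)).
Local Notation mu3 := (sgn3 (causal C)).
Local Notation mu4 := (sgn4 (causal C)).
Local Notation mu5 := (sgn5 (causal C)).

Definition psi1 (s : R) : R :=
  - (rho s * deriv_on (dom C) K1 s + K1 s ^+ 2
     + mu2 * mu3 * K2 s ^+ 2 + mu4 * mu5 * K3 s ^+ 2).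
Definition psi2 (s : R) : R := mu1 * mu3 * K2 s.
Definition psi3 (s : R) : R := 2 * mu3 * K1 s * K2 s.
Definition psi4 (s : R) : R := 2 * mu4 * K1 s * K3 s.

End Equiform.

(* Main.v *)
Require Import Defs.
From mathcomp Require Import all_boot all_order all_algebra.
From mathcomp Require Import all_classical all_reals all_analysis.
From mathcomp Require Import ring lra.
Import Order.TTheory GRing.Theory Num.Theory.
Import numFieldNormedType.Exports.
Local Open Scope classical_set_scope.
Local Open Scope ring_scope.

Set Implicit Arguments.
Unset Strict Implicit.
Unset Printing Implicit Defensive.

(** Since [d/dsigma = rho d/ds], the Frenet equations give the moving equations
      [V2' = mu1 V1 + K1 V2 + mu2 K2 V3],
      [V3' = K1 V3 + mu3 K2 V2 + mu4 K3 V4],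
      [V4' = K1 V4 + mu5 K3 V3]
    of the equiform tetrahedron, the primes being derivatives in [sigma]
    (lemmas [has_deriv_V2], [has_deriv_V3], [has_deriv_V4]). Differentiating the
    second one once more and substituting all three shows that, on every
    spacelike curve,
      [V3'' + psi1 V3 = psi2 V1 + psi3 V2 + psi4 V4
                        + rho (mu3 (dK2/ds) V2 + mu4 (dK3/ds) V4)]
    (lemma [equiform_second_deriv_V3]). The equation of the theorem thus says
    that the last term vanishes. As [V2] and [V4] are orthogonal and non-null,
    taking the scalar product with [n] and with [b2] shows that this happens
    exactly when [dK2/ds = dK3/ds = 0], that is, the domain being an interval,
    when [K2] and [K3] are constant ([has_deriv0_constant], which rests on the
    mean value theorem).

    Two points need care. Derivatives are limits of difference quotients within
    an interval that may contain its endpoints, and such a limit is meaningful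
    only if the quotient converges; the usual rules of differentiation are
    therefore established for the relation [has_deriv]. Moreover only the curve
    and the frame are assumed smooth: the differentiability of the curvatures,
    and that of [K1], come from writing [kappa1], [kappa2], [kappa3] as scalar
    products of frame vectors with derivatives of frame vectors. *)

(** * Differentiation relative to an interval *)

Section RelativeDerivative.
Context {R : realType}.
Implicit Types (I : set R) (u k : R -> R) (s : R).

(** [has_deriv I u f s l]: at [s], the derivative of [f] within [I] with respect
    to the parameter [u] exists and is [l]. *)
Definition has_deriv {V : normedModType R} I u (f : R -> V) s (l : V) : Prop :=
  diff_quotient I u f s --> l.

Definition nondegenerate_interval I :=
  is_interval I /\ exists a b, [/\ I a, I b & a < b].

(** A point of a nondegenerate interval is an accumulation point of it; this
    makes the limits of difference quotients unique. *)
Lemma within_dnbhs_proper I s :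
  nondegenerate_interval I -> I s -> ProperFilter (within I s^').
Proof.
move=> [itvI [a [b [Ia Ib ab]]]] Is; apply: Build_ProperFilter_ex => P [e /= e0 eP].
(* A point of [I] close to [s] is found towards [b] if [s < b], and towards [a]
   otherwise. *)
have [sb|bs] := ltP s b.
  pose y := s + Num.min (e / 2) ((b - s) / 2).
  have sy : s < y by rewrite ltrDl lt_min; apply/andP; split; lra.
  have yb : y < b.
    have : y <= s + (b - s) / 2 by rewrite lerD2l ge_min lexx orbT.
    lra.
  have ye : y <= s + e / 2 by rewrite lerD2l ge_min lexx.
  exists y; apply: eP.
  - by rewrite /ball_ /= ltr_norml; apply/andP; split; lra.
  - by rewrite gt_eqF.
  - by apply: (itvI s b) => //; rewrite !ltW.
have as_ : a < s by exact: lt_le_trans bs.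
pose y := s - Num.min (e / 2) ((s - a) / 2).
have ys : y < s by rewrite ltrBlDr ltrDl lt_min; apply/andP; split; lra.
have ay : a < y.
  have : s - (s - a) / 2 <= y by rewrite lerD2l lerN2 ge_min lexx orbT.
  lra.
have ye : s - e / 2 <= y by rewrite lerD2l lerN2 ge_min lexx.
exists y; apply: eP.
- by rewrite /ball_ /= ltr_norml; apply/andP; split; lra.
- by rewrite lt_eqF.
- by apply: (itvI a s) => //; rewrite !ltW.
Qed.

Lemma near_within_dnbhs I s (P : R -> Prop) :
  (forall y, I y -> y != s -> P y) -> \forall y \near within I s^', P y.
Proof.
move=> IP; rewrite near_withinE.
have : \forall y \near s^', y != s by exact: nbhs_dnbhs_neq.
by apply: filterS => y ys Iy; exact: IP.
Qed.

Section VectorValued.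
Context {V : normedModType R}.
Implicit Types (f g : R -> V).

Lemma has_derivE I u f s l :
  nondegenerate_interval I -> I s ->
  has_deriv I u f s l -> deriv_wrt I u f s = l.
Proof.
move=> nI Is fl; have := within_dnbhs_proper nI Is => PF.
exact: (@cvg_lim V (@norm_hausdorff _ V)).
Qed.

Lemma derivable_has_deriv I f s :
  derivable_on I f -> I s -> has_deriv I id f s (deriv_on I f s).
Proof. by move=> df Is; exact: df. Qed.

Lemma eq_has_deriv I u f g s l :
  {in I, f =1 g} -> I s -> has_deriv I u f s l -> has_deriv I u g s l.
Proof.
move=> fg Is; rewrite /has_deriv /diff_quotient; apply: cvg_trans.
apply: near_eq_cvg; apply: near_within_dnbhs => y Iy _.
by rewrite !fg ?inE.
Qed.

Lemma has_deriv_cvg I f s l :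
  has_deriv I id f s l -> f y @[y --> within I s^'] --> f s.
Proof.
move=> fl.
have h : (y - s) *: ((y - s)^-1 *: (f y - f s)) + f s @[y --> within I s^']
    --> (s - s) *: l + f s.
  apply: cvgD; last exact: cvg_cst.
  apply: cvgZ => //; apply: cvgB; last exact: cvg_cst.
  apply: cvg_trans; last exact: cvg_id.
  by apply: cvg_trans; [exact: cvg_within|exact: nbhs_dnbhs].
rewrite subrr scale0r add0r in h; apply: cvg_trans h.
apply: near_eq_cvg; apply: near_within_dnbhs => y _ ys.
by rewrite scalerA mulfV ?subr_eq0// scale1r subrK.
Qed.

Lemma has_derivD I f g s l m :
  has_deriv I id f s l -> has_deriv I id g s m ->
  has_deriv I id (fun y => f y + g y) s (l + m).
Proof.
move=> fl gm; rewrite /has_deriv /diff_quotient.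
under eq_fun do rewrite opprD addrACA scalerDr.
exact: cvgD.
Qed.

Lemma has_derivZ I k f s dk l :
  has_deriv I id k s dk -> has_deriv I id f s l ->
  has_deriv I id (fun y => k y *: f y) s (dk *: f s + k s *: l).
Proof.
move=> kdk fl; rewrite /has_deriv /diff_quotient.
have -> : (fun y => (id y - id s)^-1 *: (k y *: f y - k s *: f s)) =
  (fun y => ((id y - id s)^-1 *: (k y - k s)) *: f y
            + k s *: ((id y - id s)^-1 *: (f y - f s))).
  apply/funext => y; rewrite scalerA [k s * _]mulrC -!scalerA -scalerDr.
  by congr (_ *: _); rewrite scalerBl scalerBr addrA subrK.
apply: cvgD; first by apply: cvgZ => //; exact: has_deriv_cvg fl.
exact: cvgZr.
Qed.

(** Change of parameter: [df/du = (du/ds)^-1 df/ds]. *)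
Lemma has_deriv_wrt I u f s du l :
  du != 0 -> has_deriv I id u s du -> has_deriv I id f s l ->
  has_deriv I u f s (du^-1 *: l).
Proof.
move=> du0 udu fl; rewrite /has_deriv /diff_quotient.
have h : ((id y - id s)^-1 *: (u y - u s))^-1 *: ((id y - id s)^-1 *: (f y - f s))
    @[y --> within I s^'] --> du^-1 *: l.
  by apply: cvgZ => //; exact: cvgV.
apply: cvg_trans h.
apply: near_eq_cvg; apply: near_within_dnbhs => y _ ys.
rewrite scalerA; congr (_ *: _).
by rewrite invfM invrK mulrAC mulfV ?mul1r// subr_eq0.
Qed.

End VectorValued.

Lemma has_derivM I (f g : R -> R) s l m :
  has_deriv I id f s l -> has_deriv I id g s m ->
  has_deriv I id (fun y => f y * g y) s (l * g s + f s * m).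
Proof. exact: has_derivZ. Qed.

Lemma has_deriv_cst {V : normedModType R} I (c : V) s : has_deriv I id (fun=> c) s 0.
Proof.
rewrite /has_deriv /diff_quotient.
under eq_fun do rewrite subrr scaler0.
exact: cvg_cst.
Qed.

Lemma has_derivV I (k : R -> R) s dk :
  k s != 0 -> has_deriv I id k s dk ->
  has_deriv I id (fun y => (k y)^-1) s (- dk / k s ^+ 2).
Proof.
move=> ks0 kdk; rewrite /has_deriv /diff_quotient.
have kc := has_deriv_cvg kdk.
have h : - ((id y - id s)^-1 *: (k y - k s)) * ((k y)^-1 * (k s)^-1)
    @[y --> within I s^'] --> - dk * ((k s)^-1 * (k s)^-1).
  apply: cvgM; first exact: cvgN.
  by apply: cvgM; [exact: cvgV|exact: cvg_cst].
rewrite -invfM -expr2 in h; apply: cvg_trans h.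
apply: near_eq_cvg.
have : \forall y \near within I s^', k y != 0 by exact: (cvgr_neq0 _ kc).
apply: filterS => y ky0 /=; rewrite /GRing.scale/=.
move: ((y - s)^-1) => z; field.
by rewrite ky0 ks0.
Qed.

Lemma has_deriv_coord I n (f : R -> 'rV[R]_n.+1) s l j :
  has_deriv I id f s l -> has_deriv I id (fun y => f y 0 j) s (l 0 j).
Proof.
move=> fl; rewrite /has_deriv /diff_quotient.
have h := cvg_comp _ _ fl (@coord_continuous _ _ _ 0 j l).
apply: cvg_trans h; apply: near_eq_cvg; apply: near_within_dnbhs => y _ _.
by rewrite /= !mxE.
Qed.

Lemma has_deriv_mink I (f g : R -> 'rV[R]_4) s l m :
  has_deriv I id f s l -> has_deriv I id g s m ->
  has_deriv I id (fun y => mink (f y) (g y)) s (mink l (g s) + mink (f s) m).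
Proof.
move=> fl gm.
have h j := has_derivM (has_deriv_coord (j := j) fl) (has_deriv_coord (j := j) gm).
have hN := has_derivM (has_deriv_cst I (-1 : R) s) (h (inord 0)).
have := has_derivD (has_derivD (has_derivD hN (h (inord 1))) (h (inord 2))) (h (inord 3)).
rewrite /has_deriv /diff_quotient; under eq_fun do rewrite !mulN1r.
suff -> : mink l (g s) + mink (f s) m =
  0 * (f s 0 (inord 0) * g s 0 (inord 0)) +
      -1 * (l 0 (inord 0) * g s 0 (inord 0) + f s 0 (inord 0) * m 0 (inord 0)) +
      (l 0 (inord 1) * g s 0 (inord 1) + f s 0 (inord 1) * m 0 (inord 1)) +
      (l 0 (inord 2) * g s 0 (inord 2) + f s 0 (inord 2) * m 0 (inord 2)) +
      (l 0 (inord 3) * g s 0 (inord 3) + f s 0 (inord 3) * m 0 (inord 3)) by [].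
rewrite /mink; ring.
Qed.

(** The derivatives of [f] at the endpoints of [I], if any, are one-sided; the
    mean value theorem only uses two-sided derivatives inside [I], and continuity
    up to the endpoints. *)
Lemma has_deriv0_constant I f :
  nondegenerate_interval I ->
  (forall s, I s -> has_deriv I id (f : R -> R) s 0) -> constant_on I f.
Proof.
move=> [itvI [x0 [_ [Ix0 _ _]]]] f0.
suff h a b : I a -> I b -> a < b -> f a = f b.
  exists (f x0) => s Is; have [//|sx|xs] := ltgtP s x0.
  - exact: h.
  - by apply/esym; exact: h.
  - by rewrite xs.
move=> Ia Ib ab.
have sub x : a <= x <= b -> I x by exact: itvI.
have fc : {within `[a, b], continuous f}.
  apply/subspace_continuousP => x; rewrite /= in_itv/= => xab.
  have fx := has_deriv_cvg (f0 x (sub _ xab)).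
  move=> U Ux; have near_fU : \forall y \near x, y != x -> I y -> U (f y) := fx U Ux.
  suff : \forall y \near x, `[a, b]%classic y -> U (f y) by [].
  apply: filterS near_fU => y + yab; have [-> _|ne Uy] := eqVneq y x.
    exact: nbhs_singleton.
  by apply: Uy => //; apply: sub; move: yab; rewrite /= in_itv.
have fd x : x \in `]a, b[%R -> is_derive x 1 f 0.
  move=> xab; have := xab; rewrite in_itv/= => /andP[ax xb].
  have fx : (fun h : R => h^-1 *: ((f \o shift x) (h *: (1 : R)) - f x)) @ 0^' --> (0 : R).
    (* [derive] takes the limit in the increment [h], [has_deriv] in the point
       [x + h]. *)
    have shiftx : (h *: (1 : R) + x) @[h --> 0^'] --> within I x^'.
      move=> P IP.
      have {}IP : \forall y \near x, y != x -> I y -> P y := IP.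
      suff : \forall h \near (0 : R), h != 0 -> P (h *: (1 : R) + x) by [].
      have Ix : \forall y \near x, I y.
        have := near_in_itvoo xab.
        by apply: filterS => y; rewrite in_itv/= => /andP[ay yb]; apply: sub; rewrite !ltW.
      have IPx : \forall y \near x, I y /\ (y != x -> I y -> P y) by exact: filterI Ix IP.
      rewrite (near_shift 0) subr0 in IPx.
      apply: filterS IPx => h /= [Ihx Px] h0.
      rewrite [h *: _]mulr1; apply: Px => //.
      by rewrite -subr_eq0 addrK.
    have := cvg_comp _ _ shiftx (f0 x (sub _ _)).
    rewrite !ltW// => /(_ isT); apply: cvg_trans.
    rewrite [X in X @ _](_ : _ = fun h : R => h^-1 *: ((f \o shift x) (h *: (1 : R)) - f x))//.
    by apply/funext => h; rewrite /= addrK [_ *: (1 : R)]mulr1.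
  by split; [apply/cvg_ex; exists 0|exact: (@cvg_lim R (@norm_hausdorff _ R))].
have [c _] := MVT ab fd fc.
by rewrite mul0r => /eqP; rewrite subr_eq0 => /eqP.
Qed.
End RelativeDerivative.

Section DerivableFunctions.
Context {R : realType}.
Implicit Types (I : set R) (s : R).

Lemma has_deriv_cvg_quotient {V : normedModType R} I (f : R -> V) s l :
  has_deriv I id f s l -> cvg (diff_quotient I id f s).
Proof. by move=> fl; apply/cvg_ex; exists l. Qed.

Lemma smooth_has_deriv {V : normedModType R} I (f : R -> V) k s :
  smooth_on I f -> I s ->
  has_deriv I id (iter k (deriv_on I) f) s (iter k.+1 (deriv_on I) f s).
Proof. by move=> fI Is; exact: fI. Qed.

Lemma derivable_onM I (f g : R -> R) :
  derivable_on I f -> derivable_on I g -> derivable_on I (fun y => f y * g y).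
Proof.
move=> fI gI s Is; apply: has_deriv_cvg_quotient.
exact: has_derivM (fI s Is) (gI s Is).
Qed.

Lemma derivable_onD I (f g : R -> R) :
  derivable_on I f -> derivable_on I g -> derivable_on I (fun y => f y + g y).
Proof.
move=> fI gI s Is; apply: has_deriv_cvg_quotient.
exact: has_derivD (fI s Is) (gI s Is).
Qed.

Lemma derivable_on_cst I (c : R) : derivable_on I (fun=> c).
Proof. by move=> s Is; apply: has_deriv_cvg_quotient; exact: has_deriv_cst. Qed.

Lemma derivable_onV I (k : R -> R) :
  (forall s, I s -> k s != 0) ->
  derivable_on I k -> derivable_on I (fun y => (k y)^-1).
Proof.
move=> k0 kI s Is; apply: has_deriv_cvg_quotient.
exact: has_derivV (k0 s Is) (kI s Is).
Qed.

Lemma derivable_on_mink I (f g : R -> 'rV[R]_4) :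
  derivable_on I f -> derivable_on I g ->
  derivable_on I (fun y => mink (f y) (g y)).
Proof.
move=> fI gI s Is; apply: has_deriv_cvg_quotient.
exact: has_deriv_mink (fI s Is) (gI s Is).
Qed.

Lemma eq_derivable_on {V : normedModType R} I (f g : R -> V) :
  (forall s, I s -> f s = g s) -> derivable_on I f -> derivable_on I g.
Proof.
move=> fg fI s Is; apply: has_deriv_cvg_quotient.
by apply: (eq_has_deriv _ Is (fI s Is)) => y /set_mem; exact: fg.
Qed.

Lemma constant_on_has_deriv0 {V : normedModType R} I (f : R -> V) s :
  constant_on I f -> I s -> has_deriv I id f s 0.
Proof.
move=> [c fc] Is; apply: (@eq_has_deriv _ _ _ _ (fun=> c)) => //.
- by move=> y /set_mem Iy; rewrite fc.
- exact: has_deriv_cst.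
Qed.

Lemma minkDl (x y z : 'rV[R]_4) : mink (x + y) z = mink x z + mink y z.
Proof. rewrite /mink !mxE; ring. Qed.

Lemma minkZl a (x z : 'rV[R]_4) : mink (a *: x) z = a * mink x z.
Proof. rewrite /mink !mxE; ring. Qed.

Lemma minkC (x y : 'rV[R]_4) : mink x y = mink y x.
Proof. rewrite /mink; ring. Qed.

End DerivableFunctions.

(** * Equiform geometry of a spacelike curve *)

Section FrenetCurve.
Context {R : realType}.
Variable C : frenet_curve R.
Local Notation I := (dom C).
Local Notation mu1 := (sgn1 (causal C)).
Local Notation mu2 := (sgn2 (causal C)).
Local Notation mu3 := (sgn3 (causal C)).
Local Notation mu4 := (sgn4 (causal C)).
Local Notation mu5 := (sgn5 (causal C)).

Lemma dom_nondegenerate_interval : nondegenerate_interval I.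
Proof. by split; [exact: dom_interval|exact: dom_nondegenerate]. Qed.

Let nI := dom_nondegenerate_interval.

Lemma kappa1_neq0 s : I s -> kappa1 C s != 0.
Proof. by move=> /kappa1_gt0; rewrite lt0r => /andP[]. Qed.

(** Each curvature is, up to the sign of a frame vector, a scalar product of that
    vector with the derivative of the previous one; in this form its
    differentiability follows from the smoothness of the frame. *)
Lemma kappa1_mink s : I s ->
  kappa1 C s = eps_n (causal C) * mink (deriv_on I (tvec C) s) (nvec C s).
Proof.
move=> Is; have [_ nn _ _] := frame_squares Is.
rewrite frenet_t// minkZl nn; case: (causal C) => /=; ring.
Qed.

Lemma kappa2_mink s : I s ->
  kappa2 C s = eps_b1 (causal C) * mink (deriv_on I (nvec C) s) (b1vec C s).
Proof.
move=> Is; have [_ _ bb _] := frame_squares Is.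
have [_ tb _] := t_orthogonal Is.
rewrite frenet_n// minkDl !minkZl bb tb; case: (causal C); rewrite /sgn2 /=; ring.
Qed.

Lemma kappa3_mink s : I s ->
  kappa3 C s = eps_b2 (causal C) * mink (deriv_on I (b1vec C) s) (b2vec C s).
Proof.
move=> Is; have [_ _ _ bb] := frame_squares Is.
have [_ nb] := n_orthogonal Is.
rewrite frenet_b1// minkDl !minkZl bb nb; case: (causal C); rewrite /sgn4 /=; ring.
Qed.

Lemma kappa1_derivable : derivable_on I (kappa1 C).
Proof.
have [tS nS _ _] := frame_smooth C.
apply: eq_derivable_on (fun s Is => esym (kappa1_mink Is)) _.
apply: derivable_onM; first exact: derivable_on_cst.
by apply: derivable_on_mink; [exact: (tS 1)|exact: (nS 0)].
Qed.

Lemma deriv_kappa1_derivable : derivable_on I (deriv_on I (kappa1 C)).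
Proof.
have [tS nS _ _] := frame_smooth C.
apply: (@eq_derivable_on _ _ _ (fun s => eps_n (causal C) *
  (mink (iter 2 (deriv_on I) (tvec C) s) (nvec C s)
   + mink (deriv_on I (tvec C) s) (deriv_on I (nvec C) s)))).
  move=> s Is; apply/esym/has_derivE => //.
  apply: (@eq_has_deriv _ _ _ _ _ _ _ _ (fun y Iy => esym (kappa1_mink (set_mem Iy)))) => //.
  have := has_derivM (has_deriv_cst I (eps_n (causal C) : R) s)
    (has_deriv_mink (tS 1 s Is) (nS 0 s Is)).
  by rewrite mul0r add0r.
apply: derivable_onM; first exact: derivable_on_cst.
apply: derivable_onD; apply: derivable_on_mink.
- exact: (tS 2).
- exact: (nS 0).
- exact: (tS 1).
- exact: (nS 1).
Qed.

Lemma rho_derivable : derivable_on I (rho C).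
Proof. by apply: derivable_onV; [exact: kappa1_neq0|exact: kappa1_derivable]. Qed.

Lemma K1_derivable : derivable_on I (K1 C).
Proof.
apply: (@eq_derivable_on _ _ _ (fun s =>
   (-1 * deriv_on I (kappa1 C) s) * ((kappa1 C s)^-1 * (kappa1 C s)^-1))).
  move=> s Is; apply/esym/has_derivE => //; rewrite -invfM -expr2 mulN1r.
  exact: has_derivV (kappa1_neq0 Is) (kappa1_derivable Is).
apply: derivable_onM; apply: derivable_onM.
- exact: derivable_on_cst.
- exact: deriv_kappa1_derivable.
- exact: rho_derivable.
- exact: rho_derivable.
Qed.

Lemma K2_derivable : derivable_on I (K2 C).
Proof.
have [_ nS bS _] := frame_smooth C.
apply: derivable_onM; last exact: rho_derivable.
apply: eq_derivable_on (fun s Is => esym (kappa2_mink Is)) _.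
apply: derivable_onM; first exact: derivable_on_cst.
by apply: derivable_on_mink; [exact: (nS 1)|exact: (bS 0)].
Qed.

Lemma K3_derivable : derivable_on I (K3 C).
Proof.
have [_ _ bS b2S] := frame_smooth C.
apply: derivable_onM; last exact: rho_derivable.
apply: eq_derivable_on (fun s Is => esym (kappa3_mink Is)) _.
apply: derivable_onM; first exact: derivable_on_cst.
by apply: derivable_on_mink; [exact: (bS 1)|exact: (b2S 0)].
Qed.

(** The equations of motion of the equiform tetrahedron. The derivatives are in
    the arclength, hence the factor [kappa1 = dsigma/ds]. *)
Lemma has_deriv_V2 s : I s -> has_deriv I id (V2 C) s
  (kappa1 C s *: (mu1 *: V1 C s + K1 C s *: V2 C s + (mu2 * K2 C s) *: V3 C s)).
Proof.
move=> Is; have [_ nS _ _] := frame_smooth C.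
have := has_derivZ (derivable_has_deriv rho_derivable Is) (smooth_has_deriv (k := 0) nS Is).
rewrite /has_deriv; congr (_ --> _).
rewrite /= frenet_n// /V1 /V2 /V3 /K2 /rho -/(rho C) -/(K1 C).
have := kappa1_neq0 Is; move: (kappa1 C s) => k k0.
by apply/rowP => j; rewrite !mxE; field.
Qed.

Lemma has_deriv_V3 s : I s -> has_deriv I id (V3 C) s
  (kappa1 C s *: (K1 C s *: V3 C s + (mu3 * K2 C s) *: V2 C s
                  + (mu4 * K3 C s) *: V4 C s)).
Proof.
move=> Is; have [_ _ bS _] := frame_smooth C.
have := has_derivZ (derivable_has_deriv rho_derivable Is) (smooth_has_deriv (k := 0) bS Is).
rewrite /has_deriv; congr (_ --> _).
rewrite /= frenet_b1// /V2 /V3 /V4 /K2 /K3 /rho -/(rho C) -/(K1 C).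
have := kappa1_neq0 Is; move: (kappa1 C s) => k k0.
by apply/rowP => j; rewrite !mxE; field.
Qed.

Lemma has_deriv_V4 s : I s -> has_deriv I id (V4 C) s
  (kappa1 C s *: (K1 C s *: V4 C s + (mu5 * K3 C s) *: V3 C s)).
Proof.
move=> Is; have [_ _ _ bS] := frame_smooth C.
have := has_derivZ (derivable_has_deriv rho_derivable Is) (smooth_has_deriv (k := 0) bS Is).
rewrite /has_deriv; congr (_ --> _).
rewrite /= frenet_b2// /V3 /V4 /K3 /rho -/(rho C) -/(K1 C).
have := kappa1_neq0 Is; move: (kappa1 C s) => k k0.
by apply/rowP => j; rewrite !mxE; field.
Qed.

Variable sigma : R -> R.
Hypothesis sigmaP : equiform_parameter C sigma.

Lemma equiform_derivE (f : R -> 'rV[R]_4) s l :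
  I s -> has_deriv I id f s (kappa1 C s *: l) -> deriv_wrt I sigma f s = l.
Proof.
move=> Is fl; have [sigmaD sigmaE] := sigmaP.
have ds : has_deriv I id sigma s (kappa1 C s) by rewrite -sigmaE//; exact: sigmaD.
have k0 := kappa1_neq0 Is.
rewrite (has_derivE nI Is (has_deriv_wrt k0 ds fl)).
by rewrite scalerA mulVf// scale1r.
Qed.

(** The identity holds on every spacelike curve; its last term measures the
    failure of [K2] and [K3] to be constant. *)
Lemma equiform_second_deriv_V3 s : I s ->
  deriv_wrt I sigma (deriv_wrt I sigma (V3 C)) s + psi1 C s *: V3 C s
  = psi2 C s *: V1 C s + psi3 C s *: V2 C s + psi4 C s *: V4 C s
    + rho C s *: ((mu3 * deriv_on I (K2 C) s) *: V2 C s
                  + (mu4 * deriv_on I (K3 C) s) *: V4 C s).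
Proof.
move=> Is.
(* [W] is the first derivative of [V3] in [sigma], and [W'] the second one. *)
pose W y := K1 C y *: V3 C y + (mu3 * K2 C y) *: V2 C y + (mu4 * K3 C y) *: V4 C y.
have V3W : {in I, W =1 deriv_wrt I sigma (V3 C)}.
  by move=> y /set_mem Iy; rewrite (equiform_derivE Iy (has_deriv_V3 Iy)).
pose mu3K2 := has_derivM (has_deriv_cst I (mu3 : R) s) (derivable_has_deriv (K2_derivable) Is).
pose mu4K3 := has_derivM (has_deriv_cst I (mu4 : R) s) (derivable_has_deriv (K3_derivable) Is).
have dW := has_derivD (has_derivD
  (has_derivZ (derivable_has_deriv (K1_derivable) Is) (has_deriv_V3 Is))
  (has_derivZ mu3K2 (has_deriv_V2 Is))) (has_derivZ mu4K3 (has_deriv_V4 Is)).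
pose W' := (rho C s * deriv_on I (K1 C) s) *: V3 C s
  + (mu3 * (rho C s * deriv_on I (K2 C) s)) *: V2 C s
  + (mu4 * (rho C s * deriv_on I (K3 C) s)) *: V4 C s
  + K1 C s *: (K1 C s *: V3 C s + (mu3 * K2 C s) *: V2 C s + (mu4 * K3 C s) *: V4 C s)
  + (mu3 * K2 C s) *: (mu1 *: V1 C s + K1 C s *: V2 C s + (mu2 * K2 C s) *: V3 C s)
  + (mu4 * K3 C s) *: (K1 C s *: V4 C s + (mu5 * K3 C s) *: V3 C s).
rewrite (@equiform_derivE _ _ W')//.
  rewrite /W' /psi1 /psi2 /psi3 /psi4; apply/rowP => j; rewrite !mxE; ring.
apply: (eq_has_deriv V3W Is); move: dW; rewrite /has_deriv; congr (_ --> _).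
have k0 := kappa1_neq0 Is.
rewrite /W' /rho; move: (kappa1 C s) k0 => k k0.
by apply/rowP => j; rewrite !mxE; field.
Qed.

End FrenetCurve.

Theorem theorem4p3 (R : realType) (C : frenet_curve R) (sigma : R -> R)
    (hsigma : equiform_parameter C sigma) :
  general_helix C <->
  (forall s : R, dom C s ->
     deriv_wrt (dom C) sigma (deriv_wrt (dom C) sigma (V3 C)) s
       + psi1 C s *: V3 C s
     = psi2 C s *: V1 C s + psi3 C s *: V2 C s + psi4 C s *: V4 C s).
Proof.
have nI := dom_nondegenerate_interval C.
split=> [[K2c K3c] s Is|eqV3].
  rewrite equiform_second_deriv_V3//.
  have -> : deriv_on (dom C) (K2 C) s = 0.
    by apply: has_derivE => //; exact: constant_on_has_deriv0.
  have -> : deriv_on (dom C) (K3 C) s = 0.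
    by apply: has_derivE => //; exact: constant_on_has_deriv0.
  by rewrite !mulr0 !scale0r addr0 scaler0 addr0.
have K23' s : dom C s ->
    deriv_on (dom C) (K2 C) s = 0 /\ deriv_on (dom C) (K3 C) s = 0.
  move=> Is; have := eqV3 s Is; rewrite equiform_second_deriv_V3//.
  rewrite -[RHS]addr0 => /addrI.
  have r0 : rho C s != 0 by rewrite invr_eq0; exact: kappa1_neq0.
  have [_ nn _ bb] := frame_squares Is.
  have [_ nb] := n_orthogonal Is.
  set v := _ *: (_ + _) => v0.
  (* [v] is a combination of the non-null vectors [n] and [b2], which are
     orthogonal: scalar products with them isolate its coefficients. *)
  have := congr1 (mink^~ (nvec C s)) v0; have := congr1 (mink^~ (b2vec C s)) v0.
  have mink0 z : mink (0 : 'rV[R]_4) z = 0 by rewrite -(scale0r 0) minkZl mul0r.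
  rewrite /v /= !mink0 !(minkZl, minkDl) nn bb nb (minkC _ (nvec C s)) nb.
  rewrite !mulr0 addr0 add0r => /eqP + /eqP.
  rewrite !mulf_eq0 (negPf r0) /sgn4 oner_eq0 /=.
  by case: (causal C); rewrite /= ?oppr_eq0 ?oner_eq0 ?orbF /= => /eqP-> /eqP->.
split; apply: has_deriv0_constant => // s Is; have [K2' K3'] := K23' s Is.
- by rewrite -K2'; exact: K2_derivable.
- by rewrite -K3'; exact: K3_derivable.
Qed.
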